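(* Let $r\geq 2$ and $n\geq 1$ be integers such that either $r=2$, or $r$ is even and $n$ is odd. Let $K_{n,\ldots,n}$ be the complete balanced $r$-partite graph with $n$ vertices in each of its $r$ parts. Then $K_{n,\ldots,n}$ is interval total colorable and $$w_{\tau}(K_{n,\ldots,n})\leq \left(\frac{3}{2}r-2\right)n+2.$$
   Context: All graphs are finite, undirected, without loops or multiple edges. The complete balanced $r$-partite graph $K_{n,\ldots,n}$ has vertex set partitioned into $r$ independent sets $V_1,\ldots,V_r$ with $|V_i|=n$ for all $i$, and every vertex of $V_i$ is adjacent to every vertex of $V_j$ whenever $i\neq j$. A total coloring of a graph $G$ is a coloring of its vertices and edges such that no two adjacent vertices, no two adjacent edges, and no vertex and edge incident to each other get the same color. For a total coloring $\alpha$ and a vertex $v$, $S[v,\alpha]$ denotes the set consisting of $\alpha(v)$ and the colors of all edges incident to $v$. For a positive integer $t$, an interval total $t$-coloring of $G$ is a total coloring $\alpha$ of $G$ with colors $1,\ldots,t$ such that all $t$ colors are used (each on at least one vertex or edge), and for every vertex $v$ the set $S[v,\alpha]$ is an interval of integers (a set of consecutive integers). $G$ is interval total colorable if it has an interval total $t$-coloring for some positive integer $t$. For an interval total colorable graph $G$, $w_{\tau}(G)$ denotes the least value of $t$ for which $G$ has an interval total $t$-coloring. *)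

(* Defs.v *)
From HB Require Import structures.
From mathcomp Require Import all_boot all_order all_algebra.
From mathcomp Require Import boolp.

Set Implicit Arguments.
Unset Strict Implicit.
Unset Printing Implicit Defensive.

Record sgraph := SGraph {
  vertex : finType;
  adj : rel vertex;
  adj_sym : symmetric adj;
  adj_irrefl : irreflexive adj }.

Definition edges (G : sgraph) : {set {set vertex G}} :=
  [set [set p.1; p.2] | p : vertex G * vertex G & adj p.1 p.2].

Definition edge (G : sgraph) := {e : {set vertex G} | e \in edges G}.

(* A coloring assigns a color to each vertex [inl v] and each edge [inr e]. *)
Definition coloring (G : sgraph) := vertex G + edge G -> nat.

Definition total_coloring (G : sgraph) (alpha : coloring G) : Prop :=
  [/\ forall u v : vertex G, adj u v -> alpha (inl u) <> alpha (inl v),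
      forall e f : edge G, e <> f -> val e :&: val f != set0 ->
        alpha (inr e) <> alpha (inr f)
    & forall (v : vertex G) (e : edge G), v \in val e ->
        alpha (inl v) <> alpha (inr e)].

(* The set S[v, alpha], represented by the list of its elements. *)
Definition spectrum (G : sgraph) (v : vertex G) (alpha : coloring G) :
    seq nat :=
  alpha (inl v) ::
    [seq alpha (inr e) | e : edge G in [pred e : edge G | v \in val e]].

Lemma spectrumP (G : sgraph) (v : vertex G) (alpha : coloring G) (c : nat) :
  reflect (c = alpha (inl v) \/
           exists2 e : edge G, v \in val e & c = alpha (inr e))
          (c \in spectrum v alpha).
Proof.
rewrite /spectrum inE; apply: (iffP orP) => [[/eqP->|/imageP[e ve ->]]|].
- by left.
- by right; exists e.
by case=> [->|[e ve ->]]; [left | right; apply/imageP; exists e].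
Qed.

Lemma edgesP (G : sgraph) (e : {set vertex G}) :
  reflect (exists u v : vertex G, adj u v /\ e = [set u; v])
          (e \in edges G).
Proof.
apply: (iffP imsetP) => [[[u v]]|[u [v [uv ->]]]].
- by rewrite inE /= => uv ->; exists u, v.
by exists (u, v); rewrite ?inE.
Qed.

Definition is_interval (s : seq nat) : Prop :=
  exists a b : nat, forall c : nat, (c \in s) = (a <= c <= b).

Definition interval_total_coloring (G : sgraph) (t : nat)
    (alpha : coloring G) : Prop :=
  [/\ total_coloring alpha,
      forall x, 1 <= alpha x <= t,
      forall c, 1 <= c <= t -> exists x, alpha x = c
    & forall v, is_interval (spectrum v alpha)].

Definition has_interval_total_coloring (G : sgraph) (t : nat) : Prop :=
  0 < t /\ exists alpha : coloring G, interval_total_coloring t alpha.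

Definition interval_total_colorable (G : sgraph) : Prop :=
  exists t : nat, has_interval_total_coloring G t.

Lemma interval_total_colorableb (G : sgraph) :
  interval_total_colorable G ->
  exists t : nat, `[< has_interval_total_coloring G t >].
Proof. by case=> t Ht; exists t; apply/asboolP. Qed.

Definition w_tau (G : sgraph) (colG : interval_total_colorable G) : nat :=
  ex_minn (interval_total_colorableb colG).

Lemma w_tauP (G : sgraph) (colG : interval_total_colorable G) :
  has_interval_total_coloring G (w_tau colG) /\
  forall t, has_interval_total_coloring G t -> w_tau colG <= t.
Proof.
rewrite /w_tau; case: ex_minnP => m /asboolP Hm min_m; split=> // t Ht.
by apply: min_m; apply/asboolP.
Qed.

(* The vertex (i, j) is the j-th vertex of the i-th part. *)
Section CompleteBalancedMultipartite.
Variables r n : nat.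

Definition multipartite_adj : rel ('I_r * 'I_n) := fun u v => u.1 != v.1.

Lemma multipartite_adj_sym : symmetric multipartite_adj.
Proof. by move=> u v; rewrite /multipartite_adj eq_sym. Qed.

Lemma multipartite_adj_irrefl : irreflexive multipartite_adj.
Proof. by move=> u; rewrite /multipartite_adj eqxx. Qed.

Definition complete_balanced_multipartite : sgraph :=
  SGraph multipartite_adj_sym multipartite_adj_irrefl.

End CompleteBalancedMultipartite.

(* Main.v *)
Require Import Defs.
From mathcomp Require Import all_boot all_order all_algebra.
From mathcomp Require Import zify ring.
Import Order.TTheory GRing.Theory Num.Theory.

(** Write [r = 2 (p + 1)]. On the vertices [0, ..., 2p] and [oo = 2p + 1], color
the edges of the complete graph by the circular one-factorization
[(x + y) / 2 mod 2p + 1] (and [x] for the edge joining [x] to [oo]). Choosing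
suitable representatives of the residues, the edges at [x] get the interval of
length [2p + 1] starting at [ceil (x / 2)], or at [0] for [oo]: so each of the
starting points [0, ..., p] belongs to exactly two vertices. Blowing up each vertex
to [n] vertices, and each edge of color [c] to a copy of [K_{n,n}] properly colored
with [c n + 2, ..., c n + n + 1], gives intervals of length [(r - 1) n]. Of two parts
with the same interval, the vertices of one take the color just below it, and
those of the other the color just above it. *)

(** * Total colorings given by functions of vertices and ordered pairs *)

Section ColoringFromPairs.

Lemma set2_inj {T : finType} {a b u v : T} :
  [set a; b] = [set u; v] -> (a = u /\ b = v) \/ (a = v /\ b = u).
Proof.
move=> E.
have := set21 a b; have := set22 a b; rewrite E => /set2P hb /set2P ha.
have := set21 u v; have := set22 u v; rewrite -E => /set2P hv /set2P hu.
by case: ha hb hu hv => -> [] -> [] ? [] ?; auto.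
Qed.

Context {G : sgraph} (f : vertex G -> nat) (g : vertex G -> vertex G -> nat).

(** Edges are unordered, so [pick] chooses an orientation, which is immaterial once [g] is
    symmetric; every edge has one, so the default [0] is never taken. *)
Definition coloring_of_pairs : coloring G := fun x =>
  match x with
  | inl v => f v
  | inr e => if [pick p | adj p.1 p.2 && (val e == [set p.1; p.2])] is Some p
             then g p.1 p.2 else 0
  end.

Hypothesis g_sym : forall u v, g u v = g v u.

Lemma coloring_of_pairsE {e : edge G} {u v : vertex G} :
  adj u v -> val e = [set u; v] -> coloring_of_pairs (inr e) = g u v.
Proof.
move=> uv eE; rewrite /coloring_of_pairs.
case: pickP => [[a b] /= /andP[_]|/(_ (u, v))]; last by rewrite /= uv eE eqxx.
by rewrite eE => /eqP/esym/set2_inj[] [-> ->] //; rewrite g_sym.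
Qed.

Lemma edge_ends (e : edge G) (u : vertex G) :
  u \in val e -> exists2 v, adj u v & val e = [set u; v].
Proof.
case/edgesP: (valP e) => a [b [ab ->]] /set2P[] ->; first by exists b.
by exists a; rewrite 1?setUC // adj_sym.
Qed.

Lemma edge_of_adj (u v : vertex G) :
  adj u v -> exists e : edge G, val e = [set u; v].
Proof.
move=> uv; have uvE : [set u; v] \in edges G by apply/edgesP; exists u, v.
by exists (Sub [set u; v] uvE); rewrite SubK.
Qed.

(** The spectrum of [u] is exactly the interval from [lo u] to [hi u], so all [t] colors occur as
    soon as these intervals cover [1, ..., t]. *)
Lemma interval_total_coloring_of_pairs (t : nat) (lo hi : vertex G -> nat) :
    (forall u v, adj u v -> f u <> f v) ->
    (forall u v w, adj u v -> adj u w -> g u v = g u w -> v = w) ->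
    (forall u v, adj u v -> f u <> g u v) ->
    (forall u, lo u <= f u <= hi u) ->
    (forall u v, adj u v -> lo u <= g u v <= hi u) ->
    (forall u c, lo u <= c <= hi u ->
       c = f u \/ exists2 v, adj u v & c = g u v) ->
    (forall u, 0 < lo u) -> (forall u, hi u <= t) ->
    (forall c, 0 < c <= t -> exists u, lo u <= c <= hi u) ->
  interval_total_coloring t coloring_of_pairs.
Proof.
move=> ff gg fg fI gI I_fg lo0 hit cover.
have I_spec u c : (c \in spectrum u coloring_of_pairs) = (lo u <= c <= hi u).
  apply/spectrumP/idP => [[->|[e /edge_ends[v uv eE] ->]]|/I_fg[->|[v uv ->]]].
  - exact: fI.
  - by rewrite (coloring_of_pairsE uv eE) gI.
  - by left.
  have [e eE] := edge_of_adj _ _ uv; right; exists e; first by rewrite eE set21.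
  by rewrite (coloring_of_pairsE uv eE).
have itv u c : lo u <= c <= hi u -> 1 <= c <= t.
  by have := lo0 u; have := hit u; lia.
split.
- split=> // [e e' ee' /set0Pn[u]|u e /edge_ends[v uv eE]].
    rewrite inE => /andP[/edge_ends[v uv eE] /edge_ends[w uw eE']].
    rewrite (coloring_of_pairsE uv eE) (coloring_of_pairsE uw eE') => gE.
    by apply: ee'; apply: val_inj; rewrite eE eE' (gg _ _ _ uv uw gE).
  by rewrite (coloring_of_pairsE uv eE); apply: fg.
- case=> [u|e]; first exact: itv (fI u).
  case/edgesP: (valP e) => u [v [uv eE]].
  by rewrite (coloring_of_pairsE uv eE); apply: itv (gI _ _ uv).
- move=> c /cover[u]; rewrite -I_spec => /spectrumP[->|[e _ ->]].
    by exists (inl u).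
  by exists (inr e).
by move=> u; exists (lo u), (hi u); apply: I_spec.
Qed.

End ColoringFromPairs.

(** * A one-factorization of the complete graph with interval spectra *)

Section OneFactorization.
Variable p : nat.

Definition factor_start (i : nat) : nat :=
  if i == p.*2.+1 then 0 else uphalf i.

(** Adding the odd modulus to an odd sum makes the halving exact. The result is not reduced: at [i],
    even sums then fill the lower part of the window and odd sums the upper part. *)
Definition factor_color (i j : nat) : nat :=
  if i == p.*2.+1 then j else if j == p.*2.+1 then i else
  (i + j + (if odd (i + j) then p.*2.+1 else 0))./2.

Lemma factor_colorC (i j : nat) : factor_color i j = factor_color j i.
Proof. by rewrite /factor_color (addnC j); case: eqP => ?; case: eqP => ? //; lia. Qed.

Lemma factor_color_itv (i j : nat) :
    i < p.*2.+2 -> j < p.*2.+2 -> i != j ->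
  factor_start i <= factor_color i j <= factor_start i + p.*2.
Proof.
rewrite /factor_start /factor_color => ir jr ij.
case: (i =P _) => iN; first by lia.
case: (j =P _) => jN; first by lia.
by case: ifP => o; lia.
Qed.

(** Partners [j], [k] other than oo with equal colors satisfy [j = k] or differ by the modulus
    [p.*2.+1], too much for numbers at most [p.*2]. Color [i] is left to oo, as it would force
    [j = i]. *)
Lemma factor_color_inj (i j k : nat) :
    i < p.*2.+2 -> j < p.*2.+2 -> k < p.*2.+2 -> i != j -> i != k ->
  factor_color i j = factor_color i k -> j = k.
Proof.
rewrite /factor_color => ir jr kr ij ik.
case: (i =P _) => iN; first by lia.
case: (j =P _) => jN; case: (k =P _) => kN; first by lia.
- by case: ifP => o; lia.
- by case: ifP => o; lia.
by case: ifP => o; case: ifP => o'; lia.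
Qed.

Lemma factor_color_surj (i q : nat) :
    i < p.*2.+2 -> factor_start i <= q <= factor_start i + p.*2 ->
  exists j, [/\ j < p.*2.+2, i != j & factor_color i j = q].
Proof.
rewrite /factor_start /factor_color => ir.
case: (i =P _) => iN; first by move=> ?; exists q; split; lia.
have [-> ?|iq qI] := eqVneq q i; first by exists p.*2.+1; rewrite eqxx; split; lia.
(* Solve [i + j = q.*2]; when this [j] exceeds [p.*2], subtract the modulus. *)
have [small|large] := leqP q.*2 (i + p.*2).
  exists (q.*2 - i); split; [lia | lia |].
  by case: (_ =P p.*2.+1) => ?; [lia | case: ifP => o; lia].
exists (q.*2 - i - p.*2.+1); split; [lia | lia |].
by case: (_ =P p.*2.+1) => ?; [lia | case: ifP => o; lia].
Qed.

End OneFactorization.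

(** * Blowing up vertices to parts and coloring the parts *)

Section BlowUp.
Variables p n : nat.
Hypothesis n_gt0 : 0 < n.

Let vtx := ('I_p.*2.+2 * 'I_n)%type.

Definition part_low (i : nat) : nat := factor_start p i * n + (odd i).+1.

(** Equal starts occur exactly for the parts 0 and oo, and for [2k - 1] and [2k]. Each such pair has
    opposite parities, so parity decides between the color below and the color above the edges. *)
Definition part_vertex_color (i : nat) : nat :=
  factor_start p i * n + (if odd i then p.*2.+1 * n + 2 else 1).

(** Each copy of $K_{n,n}$ is colored by the addition table modulo [n], a symmetric Latin square. *)
Definition blowup_edge_color (u v : vtx) : nat :=
  factor_color p u.1 v.1 * n + (u.2 + v.2) %% n + 2.

Lemma blowup_edge_colorC u v : blowup_edge_color u v = blowup_edge_color v u.
Proof. by rewrite /blowup_edge_color factor_colorC (addnC u.2). Qed.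

Lemma modn_addl_inj (a b c : nat) :
  b < n -> c < n -> (a + b) %% n = (a + c) %% n -> b = c.
Proof. by move=> bn cn /eqP; rewrite eqn_modDl !modn_small // => /eqP. Qed.

Lemma divmod_eq (q q' s s' : nat) :
  s < n -> s' < n -> q * n + s = q' * n + s' -> q = q' /\ s = s'.
Proof.
move=> sn sn' E; have Eq : q = q'.
  by have := congr1 (divn^~ n) E; rewrite !divnMDl // !divn_small // !addn0.
by split=> //; move: E; rewrite Eq => /addnI.
Qed.

Lemma blowup_edge_color_itv (u v : vtx) : u.1 != v.1 ->
  factor_start p u.1 * n + 2 <= blowup_edge_color u v
    <= factor_start p u.1 * n + p.*2.+1 * n + 1.
Proof.
move=> uv; have := factor_color_itv p u.1 v.1 (ltn_ord _) (ltn_ord _) uv.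
rewrite /blowup_edge_color; have := ltn_pmod (u.2 + v.2) n_gt0.
by move: (_ %% n) (factor_color _ _ _) (factor_start _ _) => s q k; nia.
Qed.

Lemma blowup_edge_color_inj (u v w : vtx) : u.1 != v.1 -> u.1 != w.1 ->
  blowup_edge_color u v = blowup_edge_color u w -> v = w.
Proof.
case: u v w => [i a] [j b] [k c]; rewrite /blowup_edge_color /= => ij ik /addIn.
move=> /(divmod_eq _ _ _ _ (ltn_pmod _ n_gt0) (ltn_pmod _ n_gt0))[Fjk bc].
have jk := factor_color_inj p _ _ _ (ltn_ord i) (ltn_ord j) (ltn_ord k) ij ik Fjk.
have bc' := modn_addl_inj _ _ _ (ltn_ord b) (ltn_ord c) bc.
by congr pair; apply: val_inj.
Qed.

Lemma blowup_edge_color_surj (u : vtx) (c : nat) :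
    factor_start p u.1 * n + 2 <= c
      <= factor_start p u.1 * n + p.*2.+1 * n + 1 ->
  exists2 v : vtx, u.1 != v.1 & c = blowup_edge_color u v.
Proof.
case: u => i a /= cI; have cE := divn_eq (c - 2) n.
have sn := ltn_pmod (c - 2) n_gt0.
have qI : factor_start p i <= (c - 2) %/ n <= factor_start p i + p.*2.
  by move: cI cE sn; move: (_ %/ n) (_ %% n) (factor_start _ _) => q s k; nia.
have [j [jr ij Fj]] := factor_color_surj p i _ (ltn_ord i) qI.
(* The quotient of [c - 2] by [n] selects the part; [n - a] stands for [-a] modulo [n]. *)
exists (Ordinal jr, Ordinal (ltn_pmod (n - a + (c - 2) %% n) n_gt0)) => //.
rewrite /blowup_edge_color /= Fj modnDmr addnA subnKC; last exact/ltnW.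
by rewrite modnDl modn_mod -cE; lia.
Qed.

(** Starts are at most [p], so every color of an even part is at most [p * n + 1], below all colors
    of odd parts; within one parity the starts differ. *)
Lemma part_vertex_color_inj (i j : nat) : i < p.*2.+2 -> j < p.*2.+2 ->
  part_vertex_color i = part_vertex_color j -> i = j.
Proof.
rewrite /part_vertex_color => ir jr.
have start_le k : k < p.*2.+2 -> factor_start p k <= p.
  by rewrite /factor_start; case: eqP; lia.
have ki := start_le _ ir; have kj := start_le _ jr.
case: ifP => oi; case: ifP => oj E.
- suff: factor_start p i = factor_start p j.
    by rewrite /factor_start; case: eqP; case: eqP; lia.
  by move: E; move: (factor_start p i) (factor_start p j) => k l; nia.
- by move: ki kj E; move: (factor_start p i) (factor_start p j) => k l; nia.
- by move: ki kj E; move: (factor_start p i) (factor_start p j) => k l; nia.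
suff: factor_start p i = factor_start p j.
  by rewrite /factor_start; case: eqP; case: eqP; lia.
by move: E; move: (factor_start p i) (factor_start p j) => k l; nia.
Qed.

Lemma has_interval_total_coloring_multipartite :
  has_interval_total_coloring (complete_balanced_multipartite p.*2.+2 n)
    ((3 * p + 1) * n + 2).
Proof.
split; first by lia.
pose f (u : vtx) := part_vertex_color u.1.
exists (@coloring_of_pairs (complete_balanced_multipartite p.*2.+2 n)
  f blowup_edge_color).
apply: (@interval_total_coloring_of_pairs
    (complete_balanced_multipartite p.*2.+2 n) f _ blowup_edge_colorC _
    (fun u => part_low u.1) (fun u => part_low u.1 + p.*2.+1 * n));
  rewrite /= /multipartite_adj.
- move=> u v /eqP uv /(part_vertex_color_inj _ _ (ltn_ord _) (ltn_ord _)) E.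
  by apply: uv; apply: val_inj.
- exact: blowup_edge_color_inj.
- move=> u v /blowup_edge_color_itv; rewrite /f /part_vertex_color.
  by case: ifP => _; lia.
- by move=> u; rewrite /f /part_vertex_color /part_low; case: odd; lia.
- by move=> u v /blowup_edge_color_itv; rewrite /part_low; case: odd; lia.
- move=> u c cI; have [->|cf] := eqVneq c (f u); first by left.
  right; apply: blowup_edge_color_surj; move: cI cf.
  by rewrite /f /part_vertex_color /part_low; case: odd; lia.
- by move=> u; rewrite /part_low; lia.
- move=> u; have : factor_start p u.1 <= p.
    by rewrite /factor_start; have := ltn_ord u.1; case: eqP; lia.
  by rewrite /part_low; move: (factor_start _ _) => k; case: odd; nia.
(* [top] is the odd part with the largest start [p], namely oo when [p = 0]. Its interval ends at
   the last color and overlaps that of part 0, which begins at 1. *)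
move=> c cI; pose top := if p == 0 then 1 else p.*2.-1.
have top_lt : top < p.*2.+2 by rewrite /top; case: eqP; lia.
have top_odd : odd top by rewrite /top; case: eqP; lia.
have top_start : factor_start p top = p.
  by rewrite /factor_start /top; do 2 case: eqP; lia.
have [small|large] := leqP c (p.*2.+1 * n).
  by exists (ord0, Ordinal n_gt0); rewrite /part_low /factor_start /=; lia.
exists (Ordinal top_lt, Ordinal n_gt0).
by rewrite /part_low /= top_start top_odd; nia.
Qed.

End BlowUp.

Local Open Scope ring_scope.

Theorem theorem10 (r n : nat) (hr : (2 <= r)%N) (hn : (1 <= n)%N)
    (hrn : r = 2%N \/ (~~ odd r /\ odd n)) :
  exists colK : interval_total_colorable (complete_balanced_multipartite r n),
    (w_tau colK)%:R <= (3%:R / 2%:R * r%:R - 2%:R) * n%:R + 2%:R :> rat.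
Proof.
have [p rE] : exists p, r = p.*2.+2.
  by exists r./2.-1; case: hrn => [->//|[? _]]; lia.
subst r.
have colt := has_interval_total_coloring_multipartite p n hn.
exists (ex_intro _ _ colt).
have [_ /(_ _ colt) le_t] := w_tauP (ex_intro _ _ colt).
(* For [r = 2p + 2], the factor $\frac{3}{2}r - 2$ equals [3 * p + 1]. *)
have -> : (3%:R / 2%:R * p.*2.+2%:R - 2%:R) * n%:R + 2%:R
    = ((3 * p + 1) * n + 2)%:R :> rat.
  by rewrite -addn2 -muln2 !(natrD, natrM); field.
by rewrite ler_nat.
Qed.
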